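(* If $\Gamma$ is a $\mathbf B_h^+$-consistent set of formulas, then there is a model based on a frame $\mathfrak F\in\mathsf{CDLBWE}$ and a point of it at which every formula of $\Gamma$ is true.
   Context: A 3-frame is $\langle W,B\rangle$, $B\subseteq W^3$; $\#(x,y,z)$ means pairwise distinct. $\mathsf{DLBWE}$: 3-frames satisfying (B1) $B(x,y,z)\to\#(x,y,z)$; (B2) $B(x,y,z)\to B(z,y,x)$; (B3) $B(x,y,z)\to\neg B(x,z,y)$; (B4) $B(x,y,z)\wedge B(y,z,u)\to B(x,y,u)$; (B5) $B(x,y,z)\wedge B(y,u,z)\to B(x,y,u)$; (B6) $\#(x,y,z)\to B(x,y,z)\vee B(x,z,y)\vee B(y,x,z)$; (B7) $\forall y\exists x\exists z\,B(x,y,z)$; (B8) $x\neq z\to\exists y\,B(x,y,z)$. $\mathsf{CDLBWE}$: members of $\mathsf{DLBWE}$ satisfying (B9): for all $X,Y\subseteq W$, if there is $w$ with $B(w,x,y)$ for all $x\in X,y\in Y$, then there is $u$ with $B(x,u,y)$ for all $x\in X,y\in Y$. Language $\mathcal H_\beta(@)$: $\varphi::=\top\mid p\mid i\mid\neg\varphi\mid\varphi\wedge\psi\mid\langle B\rangle(\varphi,\psi)\mid @_i\varphi$ ($p$ propositional variables, $i$ nominals). Valuations send variables to subsets and nominals to singletons; $w\Vdash\langle B\rangle(\varphi,\psi)$ iff there are $x,y$ with $x\Vdash\varphi$, $y\Vdash\psi$, $B(x,w,y)$; $w\Vdash i$ iff $V(i)=\{w\}$; $w\Vdash @_i\varphi$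 iff the element of $V(i)$ satisfies $\varphi$. $[B]$ is the dual of $\langle B\rangle$; $\mathsf C\varphi:=\langle B\rangle(\varphi,\varphi)$. $\mathbf B_h$ has axioms: propositional tautologies; $\neg\langle B\rangle(p,q)\leftrightarrow[B](\neg p,\neg q)$; $[B](p\to q,r)\to([B](p,r)\to[B](q,r))$; $[B](r,p\to q)\to([B](r,p)\to[B](r,q))$; $@_i(p\to q)\to(@_ip\to @_iq)$; $\neg @_ip\leftrightarrow @_i\neg p$; $@_ii$; $i\wedge p\to @_ip$; $\langle B\rangle(@_ip,q)\to @_ip$; $\langle B\rangle(q,@_ip)\to @_ip$; $@_i@_jp\to @_jp$; $@_ji\to @_ij$; $@_ij\wedge @_jp\to @_ip$; $@_i\langle B\rangle(j,k)\to\neg @_ij\wedge\neg @_ik\wedge\neg @_kj$; $\langle B\rangle(i,j)\to\langle B\rangle(j,i)$; $@_j\langle B\rangle(i,k)\to\neg @_k\langle B\rangle(i,j)$; $@_j\langle B\rangle(i,k)\wedge @_k\langle B\rangle(j,l)\to @_j\langle B\rangle(i,l)\wedge @_k\langle B\rangle(i,l)$; $@_j\langle B\rangle(i,k)\wedge @_l\langle B\rangle(i,j)\to @_l\langle B\rangle(i,k)\wedge @_j\langle B\rangle(l,k)$; $\neg @_ij\wedge\neg @_ik\wedge\neg @_kj\to @_j\langle B\rangle(i,k)\vee @_k\langle B\rangle(i,j)\vee @_i\langle B\rangle(j,k)$; $\langle B\rangle(\top,\top)$; $\langle B\rangle(i,j)\to\mathsf C\mathsf C(i\vee j)$. Rules: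 modus ponens; from $\vdash\varphi$ infer $\vdash[B](\varphi,\psi)$ and $\vdash[B](\psi,\varphi)$; from $\vdash\varphi$ infer $\vdash @_i\varphi$; uniform substitution (formulas for variables, nominals for nominals); Name: from $\vdash i\to\theta$ infer $\vdash\theta$ if $i\notin\theta$; Paste: from $\vdash @_i\langle B\rangle(j,k)\wedge @_j\varphi\wedge @_k\psi\to\theta$ infer $\vdash @_i\langle B\rangle(\varphi,\psi)\to\theta$ if $i,j,k$ pairwise distinct and $j,k$ do not occur in $\varphi,\psi,\theta$. $\mathbf B_h^+$ is $\mathbf B_h$ plus the axiom (D): $\mathsf E\mathsf Cp\wedge\mathsf E\mathsf Cq\wedge\mathsf A(\mathsf Cp\to p)\wedge\mathsf A(\mathsf Cq\to q)\wedge\neg\mathsf E(p\wedge q)\to\mathsf E(\langle B\rangle(p,q)\wedge\neg\mathsf Cp\wedge\neg\mathsf Cq)$, where $\mathsf E\varphi$ abbreviates $\langle B\rangle(\varphi,\top)\vee\varphi$ and $\mathsf A\varphi:=\neg\mathsf E\neg\varphi$.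
   Formalization: In (B9) the conclusion is read non-strictly (B(x,u,y) or u=x or u=y): with strict B no non-empty frame satisfies (B1)-(B9) (take X={y}, Y={v : B(y,v,z)}), while the empty set is consistent by soundness over the reals. *)

(* Defs.v *)
From Stdlib Require Import List.
Import ListNotations.

(** * Frames *)

Record frame : Type := Frame {
  carrier :> Type;
  betw : carrier -> carrier -> carrier -> Prop
}.

Arguments betw {f} _ _ _.

Definition distinct3 {W : Type} (x y z : W) : Prop :=
  x <> y /\ x <> z /\ y <> z.

Record DLBWE (F : frame) : Prop := {
  B1 : forall x y z : F, betw x y z -> distinct3 x y z;
  B2 : forall x y z : F, betw x y z -> betw z y x;
  B3 : forall x y z : F, betw x y z -> ~ betw x z y;
  B4 : forall x y z u : F, betw x y z -> betw y z u -> betw x y u;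
  B5 : forall x y z u : F, betw x y z -> betw y u z -> betw x y u;
  B6 : forall x y z : F, distinct3 x y z -> betw x y z \/ betw x z y \/ betw y x z;
  B7 : forall y : F, exists x z : F, betw x y z;
  B8 : forall x z : F, x <> z -> exists y : F, betw x y z
}.

(** The continuity axiom is Tarski's second-order one.  Its conclusion has to be
    read with non-strict betweenness: [u] may be an endpoint.  With
    [betw x u y] in place of [wbetw x u y] no non-empty frame satisfies B1-B9,
    see [strict_B9_unsatisfiable]. *)

Definition wbetw {F : frame} (x u y : F) : Prop :=
  betw x u y \/ u = x \/ u = y.

Definition B9 (F : frame) : Prop :=
  forall X Y : F -> Prop,
    (exists w : F, forall x y : F, X x -> Y y -> betw w x y) ->
    exists u : F, forall x y : F, X x -> Y y -> wbetw x u y.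

Definition strict_B9 (F : frame) : Prop :=
  forall X Y : F -> Prop,
    (exists w : F, forall x y : F, X x -> Y y -> betw w x y) ->
    exists u : F, forall x y : F, X x -> Y y -> betw x u y.

(** Take [X := {y}] and for [Y] the open segment from [y] to some [z]. *)
Lemma strict_B9_unsatisfiable (F : frame) :
  DLBWE F -> strict_B9 F -> F -> False.
Proof.
  intros D C y.
  destruct (B7 F D y) as (x & z & Hxyz).
  destruct (C (fun v => v = y) (fun v => betw y v z)) as [u Hu].
  { exists x. intros a b -> Hb. exact (B5 F D _ _ _ _ Hxyz Hb). }
  assert (Hyz : y <> z) by apply (B1 F D _ _ _ Hxyz).
  destruct (B8 F D y z Hyz) as [v Hv].
  assert (Hyuv : betw y u v) by exact (Hu y v eq_refl Hv).
  assert (Huvz : betw u v z).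
  { apply (B2 F D). apply (B5 F D _ _ y); apply (B2 F D); assumption. }
  assert (Hyuz : betw y u z) by exact (B4 F D _ _ _ _ Hyuv Huvz).
  pose proof (Hu y u eq_refl Hyuz) as Hyuu.
  now apply (B1 F D) in Hyuu as (_ & _ & Huu).
Qed.

Definition CDLBWE (F : frame) : Prop := DLBWE F /\ B9 F.

(** * The language H_beta(@) *)

(** There are denumerably many propositional variables and nominals. *)
Definition pvar := nat.
Definition nominal := nat.

Inductive form : Type :=
| Top : form
| Var : pvar -> form
| Nom : nominal -> form
| Neg : form -> form
| And : form -> form -> form
| Dia : form -> form -> form
| At : nominal -> form -> form.

Declare Scope form_scope.
Delimit Scope form_scope with form.
Bind Scope form_scope with form.

Definition Or (f g : form) : form := Neg (And (Neg f) (Neg g)).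
Definition Imp (f g : form) : form := Neg (And f (Neg g)).
Definition Iff (f g : form) : form := And (Imp f g) (Imp g f).
Definition Box (f g : form) : form := Neg (Dia (Neg f) (Neg g)).
Definition Cf (f : form) : form := Dia f f.
Definition Ef (f : form) : form := Or (Dia f Top) f.
Definition Af (f : form) : form := Neg (Ef (Neg f)).

Notation "~~ f" := (Neg f) (at level 35, right associativity) : form_scope.
Infix "&&&" := And (at level 40, left associativity) : form_scope.
Infix "|||" := Or (at level 50, left associativity) : form_scope.
Infix "-->" := Imp (at level 55, right associativity) : form_scope.
Infix "<-->" := Iff (at level 58, no associativity) : form_scope.

(** * Semantics *)

Record model : Type := Model {
  mframe :> frame;
  val_var : pvar -> mframe -> Prop;
  val_nom : nominal -> mframe -> Prop;
  val_nom_singleton : forall i, exists! w : mframe, val_nom i w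
}.

Fixpoint sat (M : model) (w : M) (f : form) : Prop :=
  match f with
  | Top => True
  | Var p => val_var M p w
  | Nom i => forall v : M, val_nom M i v <-> v = w
  | Neg g => ~ sat M w g
  | And g h => sat M w g /\ sat M w h
  | Dia g h => exists x y : M, sat M x g /\ sat M y h /\ betw x w y
  | At i g => exists v : M, val_nom M i v /\ sat M v g
  end.

(** * Proof systems *)

(** Every formula whose main symbol is neither [Neg], [And] nor [Top] counts as
    a propositional atom. *)
Fixpoint bool_eval (a : form -> bool) (f : form) : bool :=
  match f with
  | Top => true
  | Neg g => negb (bool_eval a g)
  | And g h => andb (bool_eval a g) (bool_eval a h)
  | _ => a f
  end.

Definition tautology (f : form) : Prop :=
  forall a : form -> bool, bool_eval a f = true.

Fixpoint subst (s : pvar -> form) (t : nominal -> nominal) (f : form) : form :=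
  match f with
  | Top => Top
  | Var p => s p
  | Nom i => Nom (t i)
  | Neg g => Neg (subst s t g)
  | And g h => And (subst s t g) (subst s t h)
  | Dia g h => Dia (subst s t g) (subst s t h)
  | At i g => At (t i) (subst s t g)
  end.

Fixpoint nom_occurs (i : nominal) (f : form) : Prop :=
  match f with
  | Top => False
  | Var _ => False
  | Nom j => i = j
  | Neg g => nom_occurs i g
  | And g h => nom_occurs i g \/ nom_occurs i h
  | Dia g h => nom_occurs i g \/ nom_occurs i h
  | At j g => i = j \/ nom_occurs i g
  end.

Section Systems.
Local Open Scope form_scope.

Inductive Bh_axiom : form -> Prop :=
| ax_taut (f : form) :
    tautology f -> Bh_axiom f
| ax_dual (p q : pvar) :
    Bh_axiom (~~ Dia (Var p) (Var q) <--> Box (~~ Var p) (~~ Var q))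
| ax_K_left (p q r : pvar) :
    Bh_axiom (Box (Var p --> Var q) (Var r) -->
              (Box (Var p) (Var r) --> Box (Var q) (Var r)))
| ax_K_right (p q r : pvar) :
    Bh_axiom (Box (Var r) (Var p --> Var q) -->
              (Box (Var r) (Var p) --> Box (Var r) (Var q)))
| ax_K_at (i : nominal) (p q : pvar) :
    Bh_axiom (At i (Var p --> Var q) --> (At i (Var p) --> At i (Var q)))
| ax_selfdual (i : nominal) (p : pvar) :
    Bh_axiom (~~ At i (Var p) <--> At i (~~ Var p))
| ax_ref (i : nominal) :
    Bh_axiom (At i (Nom i))
| ax_intro (i : nominal) (p : pvar) :
    Bh_axiom (Nom i &&& Var p --> At i (Var p))
| ax_back_left (i : nominal) (p q : pvar) :
    Bh_axiom (Dia (At i (Var p)) (Var q) --> At i (Var p))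
| ax_back_right (i : nominal) (p q : pvar) :
    Bh_axiom (Dia (Var q) (At i (Var p)) --> At i (Var p))
| ax_agree (i j : nominal) (p : pvar) :
    Bh_axiom (At i (At j (Var p)) --> At j (Var p))
| ax_sym (i j : nominal) :
    Bh_axiom (At j (Nom i) --> At i (Nom j))
| ax_nom (i j : nominal) (p : pvar) :
    Bh_axiom (At i (Nom j) &&& At j (Var p) --> At i (Var p))
| ax_B1 (i j k : nominal) :
    Bh_axiom (At i (Dia (Nom j) (Nom k)) -->
              ~~ At i (Nom j) &&& ~~ At i (Nom k) &&& ~~ At k (Nom j))
| ax_B2 (i j : nominal) :
    Bh_axiom (Dia (Nom i) (Nom j) --> Dia (Nom j) (Nom i))
| ax_B3 (i j k : nominal) :
    Bh_axiom (At j (Dia (Nom i) (Nom k)) --> ~~ At k (Dia (Nom i) (Nom j)))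
| ax_B4 (i j k l : nominal) :
    Bh_axiom (At j (Dia (Nom i) (Nom k)) &&& At k (Dia (Nom j) (Nom l)) -->
              At j (Dia (Nom i) (Nom l)) &&& At k (Dia (Nom i) (Nom l)))
| ax_B5 (i j k l : nominal) :
    Bh_axiom (At j (Dia (Nom i) (Nom k)) &&& At l (Dia (Nom i) (Nom j)) -->
              At l (Dia (Nom i) (Nom k)) &&& At j (Dia (Nom l) (Nom k)))
| ax_B6 (i j k : nominal) :
    Bh_axiom (~~ At i (Nom j) &&& ~~ At i (Nom k) &&& ~~ At k (Nom j) -->
              At j (Dia (Nom i) (Nom k)) ||| At k (Dia (Nom i) (Nom j))
              ||| At i (Dia (Nom j) (Nom k)))
| ax_B7 :
    Bh_axiom (Dia Top Top)
| ax_B8 (i j : nominal) :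
    Bh_axiom (Dia (Nom i) (Nom j) --> Cf (Cf (Nom i ||| Nom j))).

Inductive D_axiom : form -> Prop :=
| ax_D (p q : pvar) :
    D_axiom (Ef (Cf (Var p)) &&& Ef (Cf (Var q))
             &&& Af (Cf (Var p) --> Var p) &&& Af (Cf (Var q) --> Var q)
             &&& ~~ Ef (Var p &&& Var q) -->
             Ef (Dia (Var p) (Var q) &&& ~~ Cf (Var p) &&& ~~ Cf (Var q))).

Inductive provable (Ax : form -> Prop) : form -> Prop :=
| pr_axiom f : Ax f -> provable Ax f
| pr_mp f g : provable Ax (f --> g) -> provable Ax f -> provable Ax g
| pr_nec_left f g : provable Ax f -> provable Ax (Box f g)
| pr_nec_right f g : provable Ax f -> provable Ax (Box g f)
| pr_nec_at i f : provable Ax f -> provable Ax (At i f)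
| pr_subst s t f : provable Ax f -> provable Ax (subst s t f)
| pr_name i f :
    ~ nom_occurs i f -> provable Ax (Nom i --> f) -> provable Ax f
| pr_paste i j k f g h :
    i <> j -> i <> k -> j <> k ->
    ~ nom_occurs j f -> ~ nom_occurs j g -> ~ nom_occurs j h ->
    ~ nom_occurs k f -> ~ nom_occurs k g -> ~ nom_occurs k h ->
    provable Ax (At i (Dia (Nom j) (Nom k)) &&& At j f &&& At k g --> h) ->
    provable Ax (At i (Dia f g) --> h).

End Systems.

Definition Bh_provable : form -> Prop := provable Bh_axiom.

Definition Bh_plus_axiom (f : form) : Prop := Bh_axiom f \/ D_axiom f.

Definition Bh_plus_provable : form -> Prop := provable Bh_plus_axiom.

Definition conj_list (l : list form) : form := fold_right And Top l.

(** No rule but modus ponens is applied to members of [G] themselves. *)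
Definition Bh_plus_consistent (G : form -> Prop) : Prop :=
  forall l : list form,
    (forall f, In f l -> G f) -> ~ Bh_plus_provable (Neg (conj_list l)).

(* Main.v *)
(** Henkin's construction with the rules Name and Paste gives a model of [G] in which every point is
    named by a nominal, so that the axioms about nominals make its betweenness that of a dense linear
    order without endpoints, while every substitution instance of (D) is true everywhere.  This model
    is then Dedekind-completed, a new point [x] receiving as its type an ultrafilter of sets cofinal in
    the lower half of its gap.  The truth lemma can only fail for [Dia f g] if [f ||| g] is cofinal in
    the lower half and false throughout the upper half.  But then both halves are definable near the
    gap, which (D) forbids. *)

From Stdlib Require Import List Arith Lia Cantor.
From Stdlib Require Import Classical IndefiniteDescription.
From Stdlib Require Import FunctionalExtensionality PropExtensionality ProofIrrelevance.
Require Import Defs.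
Import ListNotations.
Local Open Scope form_scope.

(** * Linear orders and their betweenness relations *)

(** Negation forces the type of a gap to decide every formula, hence an ultrafilter; its arbitrary
    choices do no harm. Cofinality keeps new points from offering anything new: whatever the type of
    a gap contains holds at old points of its lower half, as far up as desired, so a witness at a
    gap can be exchanged for an old point lying on the same side of the point under consideration.
    Since the types look only at lower halves, the one danger is that all witnesses of a diamond
    stay below the gap. Names serve twice: they turn the axioms about nominals into statements about
    all points, and they let (D) be applied to formulas that refer to two chosen points on either
    side of the gap. Betweenness determines an order only up to reversal, so an orientation has to
    be chosen before cuts make sense. *)

Record dense_order {W : Type} (lt : W -> W -> Prop) : Prop := {
  lt_irrefl : forall x, ~ lt x x;
  lt_trans : forall x y z, lt x y -> lt y z -> lt x z;
  lt_total : forall x y, lt x y \/ x = y \/ lt y x;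
  lt_dense : forall x z, lt x z -> exists y, lt x y /\ lt y z;
  lt_left : forall x, exists y, lt y x;
  lt_right : forall x, exists y, lt x y
}.

Definition order_betw {W : Type} (lt : W -> W -> Prop) (x y z : W) : Prop :=
  lt x y /\ lt y z \/ lt z y /\ lt y x.

Lemma order_betw_DLBWE (W : Type) (lt : W -> W -> Prop) :
  dense_order lt -> DLBWE (Frame W (order_betw lt)).
Proof.
  intros [irr tr tot den lft rgt].
  assert (asy : forall x y, lt x y -> ~ lt y x) by (intros x y H K; exact (irr _ (tr _ _ _ H K))).
  split; cbn; unfold order_betw, distinct3.
  - intros x y z [[H K]|[H K]]; (split; [|split]); intros ->;
      first [now apply irr in H | now apply irr in K | now apply asy in H].
  - tauto.
  - intros x y z [[H K]|[H K]] [[H' K']|[H' K']];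
      first [now apply (asy y z) | apply (irr x); now eauto].
  - intros x y z u [[H K]|[H K]] [[H' K']|[H' K']].
    + left. eauto.
    + now apply asy in K.
    + now apply asy in H.
    + right. eauto.
  - intros x y z u [[H K]|[H K]] [[H' K']|[H' K']].
    + left. eauto.
    + destruct (asy _ _ K). eauto.
    + destruct (asy _ _ H). eauto.
    + right. eauto.
  - intros x y z (n1 & n2 & n3).
    destruct (tot x y) as [|[|]], (tot x z) as [|[|]], (tot y z) as [|[|]]; tauto.
  - intros y. destruct (lft y) as [x ?], (rgt y) as [z ?]. exists x, z. now left.
  - intros x z n. destruct (tot x z) as [H|[H|H]]; [|easy|];
      destruct (den _ _ H) as [y ?]; exists y; tauto.
Qed.

(* If [X] and [Y] are both inhabited, the point [w] of (B9) puts all of [X] on one side of all of [Y]. *)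
Lemma order_betw_B9 (W : Type) (lt : W -> W -> Prop) :
  dense_order lt ->
  (forall X : W -> Prop, (exists x, X x) -> (exists b, forall x, X x -> lt x b) ->
     exists u, (forall x, X x -> ~ lt u x) /\
               (forall b, (forall x, X x -> ~ lt b x) -> ~ lt b u)) ->
  B9 (Frame W (order_betw lt)).
Proof.
  intros [irr tr tot den lft rgt] sup.
  assert (asy : forall x y, lt x y -> ~ lt y x) by (intros x y H K; exact (irr _ (tr _ _ _ H K))).
  assert (sep : forall X Y : W -> Prop, (exists x, X x) -> (exists y, Y y) ->
     (forall x y, X x -> Y y -> lt x y) ->
     exists u, forall x y, X x -> Y y ->
       order_betw lt x u y \/ u = x \/ u = y).
  { intros X Y HX [y0 Hy0] L. destruct (sup X HX) as [u [ub lub]]; [exists y0; auto|].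
    exists u. intros x y Hx Hy. pose proof (ub x Hx).
    assert (~ lt y u) by (apply lub; intros x' Hx'; apply asy; auto).
    unfold order_betw. destruct (tot x u) as [|[|]], (tot u y) as [|[|]]; auto; easy. }
  intros X Y [w Hw]. unfold wbetw; cbn in *.
  destruct (classic (exists x, X x)) as [[x0 Hx0]|];
    [|exists w; intros x y ? ?; exfalso; eauto].
  destruct (classic (exists y, Y y)) as [[y0 Hy0]|];
    [|exists w; intros x y ? ?; exfalso; eauto].
  destruct (Hw x0 y0 Hx0 Hy0) as [[H1 H2]|[H1 H2]].
  - apply sep; eauto. intros x y Hx Hy.
    destruct (Hw x y0 Hx Hy0) as [[]|[]]; [|destruct (irr w); eauto].
    destruct (Hw x y Hx Hy) as [[]|[]]; [easy|]. now destruct (asy w x).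
  - destruct (sep Y X) as [u Hu]; eauto.
    { intros y x Hy Hx.
      destruct (Hw x y0 Hx Hy0) as [[]|[]]; [destruct (irr w); eauto|].
      destruct (Hw x y Hx Hy) as [[]|[]]; [|easy]. now destruct (asy w x). }
    exists u. intros x y Hx Hy. destruct (Hu y x Hy Hx) as [[?|?]|[?|?]]; unfold order_betw; tauto.
Qed.

(** * The order of a betweenness relation *)

Section Betweenness.
Context {W : Type} (B : W -> W -> W -> Prop).
Hypothesis b1 : forall x y z, B x y z -> distinct3 x y z.
Hypothesis b2 : forall x y z, B x y z -> B z y x.
Hypothesis b3 : forall x y z, B x y z -> ~ B x z y.
Hypothesis b4 : forall x y z u, B x y z -> B y z u -> B x y u.
Hypothesis b5 : forall x y z u, B x y z -> B y u z -> B x y u.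
Hypothesis b6 : forall x y z, distinct3 x y z -> B x y z \/ B x z y \/ B y x z.

(** The order in which [o] precedes [b]: the points [x] with [B x o b] are those below [o]. *)
Definition betw_lt (o b x y : W) : Prop :=
  x <> y /\
  (x = o /\ ~ B y o b \/ y = o /\ B x o b \/ B x o y /\ B x o b \/
   B o x y /\ ~ B x o b \/ B o y x /\ B x o b).

(** * Refuting arrangements of finitely many points *)

Ltac add H :=
  let T := type of H in
  match goal with
  | _ : T |- _ => fail 1
  | _ => pose proof H
  end.

(** No rule creates a new point and [add] refuses known facts, so the closure is finite. *)
Ltac saturate :=
  repeat match goal with
  | H : B ?x ?y ?z, K : B ?x ?z ?y |- _ => destruct (b3 _ _ _ H K)
  | H : B ?x ?y ?z, K : ~ B ?x ?y ?z |- _ => destruct (K H)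
  | H : B ?x ?x ?z |- _ => destruct (b1 _ _ _ H) as ([] & _); reflexivity
  | H : B ?x ?z ?z |- _ => destruct (b1 _ _ _ H) as (_ & _ & []); reflexivity
  | H : B ?x ?z ?x |- _ => destruct (b1 _ _ _ H) as (_ & [] & _); reflexivity
  | H : B ?x ?y ?z |- _ => add (b2 _ _ _ H)
  | H : B ?x ?y ?z, K : B ?y ?z ?u |- _ => add (b4 _ _ _ _ H K)
  | H : B ?x ?y ?z, K : B ?y ?u ?z |- _ => add (b5 _ _ _ _ H K)
  end.

(** The last case of the outer match is essential: without it a failure at one leaf would backtrack
    over all arrangements. *)
Ltac arrangements :=
  saturate;
  match goal with
  | x : W, y : W |- _ =>
    lazymatch goal with
    | _ : x <> y |- _ => fail
    | _ => destruct (classic (x = y)); [subst | assert (y <> x) by auto]; arrangements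
    end
  | x : W, y : W, z : W |- _ =>
    lazymatch goal with
    | _ : B x y z |- _ => fail
    | _ : B x z y |- _ => fail
    | _ : B y x z |- _ => fail
    | _ : x <> y, _ : x <> z, _ : y <> z |- _ =>
      destruct (b6 x y z) as [|[|]]; [now split|..]; arrangements
    end
  | _ => try tauto
  end.

Lemma betw_lt_total o b x y : o <> b -> x <> y -> betw_lt o b x y \/ betw_lt o b y x.
Proof.
  unfold betw_lt. intros. destruct (classic (B x o b)), (classic (B y o b)); arrangements.
Qed.

Lemma betw_lt_asym o b x y : o <> b -> betw_lt o b x y -> ~ betw_lt o b y x.
Proof.
  intros ? [? H1] [? H2].
  destruct H1 as [[]|[[]|[[]|[[]|[]]]]], H2 as [[]|[[]|[[]|[[]|[]]]]]; subst; arrangements.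
Qed.

Lemma betw_lt_betw o b x y z : o <> b -> betw_lt o b x y -> betw_lt o b y z -> B x y z.
Proof.
  intros ob H1 H2.
  assert (x <> z) by (intros ->; exact (betw_lt_asym _ _ _ _ ob H1 H2)).
  apply NNPP; intro. destruct H1 as [? H1], H2 as [? H2].
  destruct H1 as [[]|[[]|[[]|[[]|[]]]]], H2 as [[]|[[]|[[]|[[]|[]]]]]; subst; arrangements.
Qed.

(** A cycle through [x], [y], [z] would give both [B x y z] and [B z x y], against [b3]. *)
Lemma betw_lt_trans o b x y z :
  o <> b -> betw_lt o b x y -> betw_lt o b y z -> betw_lt o b x z.
Proof.
  intros ob H1 H2. pose proof (betw_lt_betw _ _ _ _ _ ob H1 H2) as K.
  destruct (betw_lt_total o b x z ob) as [|H3]; [|easy|].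
  - now destruct (b1 _ _ _ K) as (_ & ? & _).
  - destruct (b3 z y x); [now apply b2|]. now apply (betw_lt_betw o b).
Qed.

(** For the direction from [B]: if the order put an end point in the middle, [betw_lt_betw] would do
    the same for [B], against [b3]. *)
Lemma order_betw_betw_lt o b x y z : o <> b -> B x y z <-> order_betw (betw_lt o b) x y z.
Proof.
  intros ob. split.
  - intros K. destruct (b1 _ _ _ K) as (n1 & n2 & n3). unfold order_betw.
    destruct (betw_lt_total o b x y ob n1) as [H1|H1], (betw_lt_total o b y z ob n3) as [H2|H2]; auto;
      exfalso; destruct (betw_lt_total o b x z ob n2) as [H3|H3].
    + exact (b3 _ _ _ K (betw_lt_betw _ _ _ _ _ ob H3 H2)).
    + exact (b3 _ _ _ (b2 _ _ _ K) (betw_lt_betw _ _ _ _ _ ob H3 H1)).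
    + exact (b3 _ _ _ (b2 _ _ _ K) (b2 _ _ _ (betw_lt_betw _ _ _ _ _ ob H1 H3))).
    + exact (b3 _ _ _ K (b2 _ _ _ (betw_lt_betw _ _ _ _ _ ob H2 H3))).
  - intros [[H K]|[H K]]; [|apply b2]; now apply (betw_lt_betw o b).
Qed.

Hypothesis b7 : forall y, exists x z, B x y z.
Hypothesis b8 : forall x y z, B x y z -> exists u v, B x u z /\ B x v z /\ B u y v.

Lemma betw_order (w : W) :
  exists lt, dense_order lt /\ forall x y z, B x y z <-> order_betw lt x y z.
Proof.
  destruct (b7 w) as (o & b & K). destruct (b1 _ _ _ K) as (_ & ob & _).
  exists (betw_lt o b). split; [|intros; now apply order_betw_betw_lt].
  pose proof (fun x y z => betw_lt_trans o b x y z ob) as tr.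
  assert (irr : forall x, ~ betw_lt o b x x) by now intros x [].
  assert (rgt : forall x, exists y, betw_lt o b x y).
  { intros x. destruct (b7 x) as (y & z & L). apply (order_betw_betw_lt o b) in L as [[]|[]]; eauto. }
  split; auto.
  - intros x y. destruct (classic (x = y)); [auto|].
    destruct (betw_lt_total o b x y ob); auto.
  - (* [b8] applies only to points already lying between two others, so [z] is put between [x] and [c]. *)
    intros x z L. destruct (rgt z) as [c Lc].
    destruct (b8 x z c) as (u & v & Hu & Hv & H); [now apply (betw_lt_betw o b)|].
    assert (up : forall y, B x y c -> betw_lt o b x y).
    { intros y Hy. apply (order_betw_betw_lt o b) in Hy as [[]|[L1 L2]]; [easy| |easy].
      destruct (irr x). eauto. }
    (* [u] and [v] lie on either side of [z]; the one below [z] is the point sought. *)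
    apply (order_betw_betw_lt o b) in H as [[]|[]]; eauto.
  - intros x. destruct (b7 x) as (y & z & L). apply (order_betw_betw_lt o b) in L as [[]|[]]; eauto.
Qed.
End Betweenness.

(** * Countably many dense conditions *)

(** [n] bounds the recursion depth. *)
Fixpoint decode (n c : nat) : form :=
  match n with
  | 0 => Top
  | S n =>
      let (t, c) := of_nat c in
      let (a, b) := of_nat c in
      match t with
      | 0 => Top
      | 1 => Var c
      | 2 => Nom c
      | 3 => Neg (decode n c)
      | 4 => And (decode n a) (decode n b)
      | 5 => Dia (decode n a) (decode n b)
      | _ => At a (decode n b)
      end
  end.

(** One code has to work for all larger depth bounds, so that the bounds of two subformulas can be
    added. *)
Lemma decode_surj f : exists N c, forall n, N <= n -> decode n c = f.
Proof.
  assert (S_le : forall N n, S N <= n -> exists n', n = S n' /\ N <= n')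
    by (intros N [|n] L; [lia|exists n; split; [easy|lia]]).
  induction f as [|p|i|f [N [c IH]]|f [N [c IH]] g [N' [c' IH']]
                 |f [N [c IH]] g [N' [c' IH']]|i f [N [c IH]]];
  [ exists 1, (to_nat (0, 0)) | exists 1, (to_nat (1, p)) | exists 1, (to_nat (2, i))
  | exists (S N), (to_nat (3, c)) | exists (S (N + N')), (to_nat (4, to_nat (c, c')))
  | exists (S (N + N')), (to_nat (5, to_nat (c, c'))) | exists (S N), (to_nat (6, to_nat (i, c)))];
  intros n L; apply S_le in L as (n' & -> & L); cbn [decode];
  rewrite !cancel_of_to; try rewrite IH by lia; try rewrite IH' by lia; try easy;
  try (now destruct (of_nat _)).
Qed.

Lemma form_enumeration : exists e : nat -> form, forall f, exists n, e n = f.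
Proof.
  exists (fun k => let (n, c) := of_nat k in decode n c). intros f.
  destruct (decode_surj f) as (N & c & H). exists (to_nat (N, c)).
  rewrite cancel_of_to. now apply H.
Qed.

(** With formulas as conditions this is Lindenbaum's lemma, with cofinal sets an ultrafilter theorem. *)
Lemma generic_sequence (A : Type) (le : A -> A -> Prop) (Con : A -> Prop)
    (Good : form -> A -> Prop) (a0 : A) :
  (forall a, le a a) -> (forall a b c, le a b -> le b c -> le a c) ->
  (forall f a, Con a -> exists b, Con b /\ le b a /\ Good f b) ->
  Con a0 ->
  exists s : nat -> A,
    s 0 = a0 /\ (forall n, Con (s n)) /\ (forall m n, m <= n -> le (s n) (s m)) /\
    (forall f, exists n, Good f (s n)).
Proof.
  intros refl trans step C0. destruct form_enumeration as [e He].
  assert (exists F : nat * {a | Con a} -> {a | Con a},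
    forall p, le (proj1_sig (F p)) (proj1_sig (snd p)) /\ Good (e (fst p)) (proj1_sig (F p))) as [F HF].
  { apply (functional_choice (fun (p : nat * {a | Con a}) (b : {a | Con a}) =>
      le (proj1_sig b) (proj1_sig (snd p)) /\ Good (e (fst p)) (proj1_sig b))).
    intros [n [a Ca]]. destruct (step (e n) a Ca) as (b & Cb & ?). now exists (exist _ b Cb). }
  set (s := fix s n := match n with 0 => exist _ a0 C0 | S n => F (n, s n) end).
  exists (fun n => proj1_sig (s n)). split; [easy|]. split; [|split].
  - intros n. apply proj2_sig.
  - intros m n L. induction L as [|n L IH]; [easy|].
    apply (trans _ (proj1_sig (s n))); [|easy]. apply (HF (n, s n)).
  - intros f. destruct (He f) as [n <-]. exists (S n). apply (HF (n, s n)).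
Qed.

(** * Dedekind completion of a model *)

Definition D_instance (f g : form) : form :=
  Ef (Cf f) &&& Ef (Cf g) &&& Af (Cf f --> f) &&& Af (Cf g --> g) &&& ~~ Ef (f &&& g) -->
  Ef (Dia f g &&& ~~ Cf f &&& ~~ Cf g).

Lemma sat_Neg (M : model) (w : M) f : sat M w (~~ f) <-> ~ sat M w f.
Proof. reflexivity. Qed.

Lemma sat_And (M : model) (w : M) f g : sat M w (f &&& g) <-> sat M w f /\ sat M w g.
Proof. reflexivity. Qed.

Lemma sat_Or (M : model) (w : M) f g : sat M w (f ||| g) <-> sat M w f \/ sat M w g.
Proof. cbn. tauto. Qed.

Lemma sat_Imp (M : model) (w : M) f g : sat M w (f --> g) <-> (sat M w f -> sat M w g).
Proof. cbn. tauto. Qed.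

Section Completion.

Context (M : model) (lt : M -> M -> Prop) (O : dense_order lt).
Hypothesis betw_lt : forall x y z : M, betw x y z <-> order_betw lt x y z.
Hypothesis named : forall w : M, exists i, val_nom M i w.
Hypothesis D_valid : forall f g w, sat M w (D_instance f g).

Let irr := lt_irrefl lt O.
Let tr := lt_trans lt O.
Let tot := lt_total lt O.
Let den := lt_dense lt O.

Lemma lt_asym x y : lt x y -> ~ lt y x.
Proof. intros H K; exact (irr _ (tr _ _ _ H K)). Qed.

Lemma sat_Dia (w : M) f g :
  sat M w (Dia f g) <-> exists x y, sat M x f /\ sat M y g /\ order_betw lt x w y.
Proof.
  cbn. split; intros (x & y & ? & ? & H); exists x, y; apply betw_lt in H || apply betw_lt; auto.
Qed.

(** Without end points, any [v] other than [w] has a partner on the other side of [w], which serves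
    as the witness of [Top]. *)
Lemma sat_Ef (w : M) f : sat M w (Ef f) <-> exists v, sat M v f.
Proof.
  unfold Ef. rewrite sat_Or, sat_Dia. split.
  - intros [(x & _ & H & _)|H]; eauto.
  - intros [v H]. destruct (tot v w) as [L|[->|L]]; [left| now right |left].
    + destruct (lt_right lt O w) as [u ?]. exists v, u. cbn. unfold order_betw. auto 8.
    + destruct (lt_left lt O w) as [u ?]. exists v, u. cbn. unfold order_betw. auto 8.
Qed.

Lemma sat_Af (w : M) f : sat M w (Af f) <-> forall v, sat M v f.
Proof.
  unfold Af. cbn [sat]. rewrite sat_Ef. cbn. split; [|firstorder].
  intros H v. apply NNPP. eauto.
Qed.

Lemma sat_Nom i (m w : M) : val_nom M i m -> (sat M w (Nom i) <-> w = m).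
Proof.
  intros H. destruct (val_nom_singleton M i) as (m' & H' & U). cbn.
  split.
  - intros K. symmetry. now apply K.
  - intros -> v. split; [intros V|now intros ->]. now rewrite <- (U v V), <- (U m H).
Qed.

(** [low_open] excludes a greatest element, so that each point of [M] yields one cut and not two. *)
Record cut : Type := Cut {
  low : M -> Prop;
  low_inhabited : exists m, low m;
  low_proper : exists m, ~ low m;
  low_down : forall m n, lt m n -> low n -> low m;
  low_open : forall m, low m -> exists n, lt m n /\ low n
}.

Lemma cut_eq (x y : cut) : (forall m, low x m <-> low y m) -> x = y.
Proof.
  destruct x as [lx ? ? ? ?], y as [ly ? ? ? ?]; cbn. intros H.
  assert (lx = ly) as <- by (extensionality m; now apply propositional_extensionality).
  f_equal; apply proof_irrelevance.
Qed.

(** For lower sets of a linear order this is proper inclusion. *)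
Definition cut_lt (x y : cut) : Prop := exists m, low y m /\ ~ low x m.

Lemma low_above (x : cut) m n : low x m -> ~ low x n -> lt m n.
Proof.
  intros Hm Hn. destruct (tot m n) as [|[->|L]]; [easy|easy|].
  destruct Hn. now apply (low_down x _ m).
Qed.

Definition principal (m : M) : cut.
Proof.
  refine (Cut (fun n => lt n m) (lt_left lt O m) (ex_intro _ m (irr m)) (fun k n => tr k n m) _).
  intros k L. destruct (den _ _ L) as (n & ? & ?). now exists n.
Defined.

Lemma cut_lt_principal_l m (x : cut) : cut_lt (principal m) x <-> low x m.
Proof.
  split.
  - intros (n & Hn & K). cbn in K. destruct (tot m n) as [L|[->|L]]; [|easy|easy].
    now apply (low_down x _ n).
  - intros H. exists m. split; [easy|apply irr].
Qed.

(** The converse fails exactly for [x = principal m]; the rest of it is [gap_above]. *)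
Lemma cut_lt_principal_r m (x : cut) : cut_lt x (principal m) -> ~ low x m.
Proof. intros (n & Hn & K) H. apply K. now apply (low_down x _ m). Qed.

Lemma cut_lt_principal m n : cut_lt (principal m) (principal n) <-> lt m n.
Proof. apply cut_lt_principal_l. Qed.

Lemma principal_inj m n : principal m = principal n -> m = n.
Proof.
  intros E. assert (K : forall k, lt k m <-> lt k n).
  { intros k. change (low (principal m) k <-> low (principal n) k). now rewrite E. }
  destruct (tot m n) as [H|[H|H]]; [|easy|]; apply K in H; now apply irr in H.
Qed.

Lemma gap_above (x : cut) m : x <> principal m -> ~ low x m -> cut_lt x (principal m).
Proof.
  intros N H. apply NNPP; intro C. apply N, cut_eq. intros n; cbn. split.
  - intros Hn. now apply (low_above x).
  - intros L. apply NNPP; intro K. apply C. now exists n.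
Qed.

Lemma cut_order : dense_order cut_lt.
Proof.
  split.
  - intros x (m & ? & ?). easy.
  - intros x y z (m & H1 & H2) (n & H3 & H4). exists m. split; [|easy].
    apply (low_down z _ n); [|easy]. now apply (low_above y).
  - intros x y. destruct (classic (cut_lt x y)) as [|H]; [now left|right].
    destruct (classic (cut_lt y x)) as [|K]; [now right|left].
    apply cut_eq. intros m. split; intros; apply NNPP; intro;
      [apply K|apply H]; now exists m.
  (* [principal m] may be [x] itself, hence the larger [n]. *)
  - intros x z (m & H1 & H2). destruct (low_open z m H1) as (n & L & Hn).
    exists (principal n). rewrite cut_lt_principal_l. split; [|easy]. now exists m.
  - intros x. destruct (low_inhabited x) as [m H]. exists (principal m). now apply cut_lt_principal_l.
  - intros x. destruct (low_proper x) as [m H]. destruct (lt_right lt O m) as [n L].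
    exists (principal n). now exists m.
Qed.

Lemma cut_sup (X : cut -> Prop) :
  (exists x, X x) -> (exists b, forall x, X x -> cut_lt x b) ->
  exists u, (forall x, X x -> ~ cut_lt u x) /\
            (forall b, (forall x, X x -> ~ cut_lt b x) -> ~ cut_lt b u).
Proof.
  intros [x0 H0] [b Hb].
  (* The supremum is the union of the lower halves; the bound [b] keeps it proper. *)
  unshelve eexists (Cut (fun m => exists x, X x /\ low x m) _ _ _ _); cbn.
  - destruct (low_inhabited x0) as [m ?]. eauto.
  - destruct (low_proper b) as [m Hm]. exists m. intros (x & Hx & L).
    destruct (Hb x Hx) as (n & Hn & K). apply K. apply (low_down x _ m); [|easy].
    now apply (low_above b).
  - intros m n L (x & ? & ?). exists x. split; [easy|]. now apply (low_down x _ n).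
  - intros m (x & ? & H). apply low_open in H as (n & ? & ?). eauto 6.
  - split.
    + intros x Hx (m & H1 & H2). apply H2. cbn. eauto.
    + intros c Hc (m & (x & Hx & Hm) & K). apply (Hc x Hx). now exists m.
Qed.

Definition cofinal (x : cut) (S : M -> Prop) : Prop :=
  forall m, low x m -> exists n, lt m n /\ low x n /\ S n.

(* Otherwise, for [a] below and [b] above the gap, the two parts of the open interval from [a] to [b]
   would be definable, and (D) would yield a point in the gap.  The parts have to be bounded: nominals
   do not suffice to tell the far left from the far right. *)
Lemma no_definable_gap (x : cut) f :
  (forall m, x <> principal m) -> cofinal x (fun m => sat M m f) ->
  exists m, ~ low x m /\ sat M m f.
Proof.
  intros G C. apply NNPP; intro N.
  destruct (low_inhabited x) as [a Ha]. destruct (low_proper x) as [b Hb].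
  destruct (named a) as [i Hi]. destruct (named b) as [j Hj].
  assert (below : forall m, sat M m f -> low x m) by (intros m Hm; apply NNPP; eauto).
  assert (ab : lt a b) by now apply (low_above x).
  assert (I : forall w, sat M w (Dia (Nom i) (Nom j)) <-> lt a w /\ lt w b).
  { intros w. rewrite sat_Dia. split.
    - intros (y & z & Hy & Hz & K). apply (sat_Nom i a) in Hy as ->; [|easy].
      apply (sat_Nom j b) in Hz as ->; [|easy]. destruct K as [|[K1 K2]]; [easy|].
      destruct (lt_asym _ _ ab). eauto.
    - intros K. exists a, b. split; [now apply (sat_Nom i a)|].
      split; [now apply (sat_Nom j b)|]. now left. }
  set (p := Dia (Nom i) (Nom j) &&& Dia (Nom i) f).
  set (q := Dia (Nom i) (Nom j) &&& ~~ Dia (Nom i) f).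
  (* As [f] is cofinal below the gap and false above it, a point beyond [a] is below the gap iff [f]
     holds somewhere further up. *)
  assert (F : forall w, lt a w -> (sat M w (Dia (Nom i) f) <-> low x w)).
  { intros w L. rewrite sat_Dia. split.
    - intros (y & z & Hy & Hz & K). apply (sat_Nom i a) in Hy as ->; [|easy].
      destruct K as [[_ K]|[_ K]]; [|now destruct (lt_asym _ _ L)].
      apply (low_down x _ z); auto.
    - intros Hw. destruct (C w Hw) as (n & ? & ? & ?). exists a, n.
      split; [now apply (sat_Nom i a)|]. split; [easy|]. now left. }
  assert (P : forall w, sat M w p <-> lt a w /\ low x w).
  { intros w. unfold p. rewrite sat_And, I. split.
    - intros [[L _] H]. split; [easy|]. now apply F.
    - intros [L H]. split; [split; [easy|now apply (low_above x)]|]. now apply F. }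
  assert (Q : forall w, sat M w q <-> ~ low x w /\ lt w b).
  { intros w. unfold q. rewrite sat_And, sat_Neg, I. split.
    - intros [[L L'] H]. split; [|easy]. now rewrite <- (F w).
    - intros [H L]. assert (lt a w) by now apply (low_above x). rewrite (F w); auto. }
  assert (mid : forall w h, sat M w (Cf h) <->
            exists y z, sat M y h /\ sat M z h /\ lt y w /\ lt w z).
  { intros w h. unfold Cf. rewrite sat_Dia. split.
    - intros (y & z & ? & ? & [[]|[]]); [exists y, z|exists z, y]; auto.
    - intros (y & z & ? & ? & ? & ?). exists y, z. repeat split; auto. now left. }
  pose proof (D_valid p q a) as D. unfold D_instance in D.
  rewrite sat_Imp, sat_Ef in D. destruct D as [w Hw].
  - repeat split.
    + apply sat_Ef. destruct (low_open x a Ha) as (m1 & L1 & H1).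
      destruct (low_open x m1 H1) as (m2 & L2 & H2).
      destruct (low_open x m2 H2) as (m3 & L3 & H3).
      assert (lt a m3) by exact (tr _ _ _ L1 (tr _ _ _ L2 L3)).
      exists m2. apply mid. exists m1, m3. rewrite (P m1), (P m3). auto.
    + apply sat_Ef.
      (* The upper half has no least point, since such a point would make [x] principal. *)
      assert (R : forall c, ~ low x c -> exists c', ~ low x c' /\ lt c' c).
      { intros c Hc. destruct (gap_above x c) as (c' & ? & ?); eauto. }
      destruct (R b Hb) as (m1 & H1 & L1). destruct (R m1 H1) as (m2 & H2 & L2).
      destruct (R m2 H2) as (m3 & H3 & L3).
      assert (lt m3 b) by exact (tr _ _ _ L3 (tr _ _ _ L2 L1)).
      exists m2. apply mid. exists m3, m1. rewrite (Q m1), (Q m3). auto.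
    + apply sat_Af. intros w. rewrite sat_Imp, mid, P.
      intros (y & z & Hy & Hz & L1 & L2). rewrite P in Hy, Hz. split; [now apply (tr _ y)|].
      now apply (low_down x _ z).
    + apply sat_Af. intros w. rewrite sat_Imp, mid, Q.
      intros (y & z & Hy & Hz & L1 & L2). rewrite Q in Hy, Hz. split; [|now apply (tr _ z)].
      intros H. apply Hy. now apply (low_down x _ w).
    + cbn [sat]. rewrite sat_Ef. intros (w & Hp & Hq). apply P in Hp. apply Q in Hq. tauto.
  - rewrite !sat_And, !sat_Neg, !mid in Hw. destruct Hw as [[Hw Np] Nq].
    apply sat_Dia in Hw as (y & z & Hy & Hz & K). pose proof Hy as Hy'. pose proof Hz as Hz'.
    apply P in Hy' as [Hy1 Hy2]. apply Q in Hz' as [Hz1 Hz2].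
    assert (lt y z) by now apply (low_above x).
    destruct K as [[L1 L2]|[L1 L2]]; [|now destruct (lt_asym y z); eauto].
    (* Neither half has an extreme point at the gap, so [w] lies between two points of its own half,
       against [Np] or [Nq]. *)
    destruct (classic (low x w)) as [Lw|Lw].
    + apply Np. destruct (low_open x w Lw) as (n & Ln & ?).
      assert (lt a n) by exact (tr _ _ _ Hy1 (tr _ _ _ L1 Ln)).
      exists y, n. rewrite (P n). auto.
    + apply Nq. destruct (gap_above x w) as (n & Ln & ?); auto.
      assert (lt n b) by exact (tr _ _ _ Ln (tr _ _ _ L2 Hz2)).
      exists n, z. rewrite (Q n). auto.
Qed.

(** * Types of the points of the completion *)

Definition full_type (T : form -> Prop) : Prop :=
  T Top /\ (forall f, T (~~ f) <-> ~ T f) /\ (forall f g, T (f &&& g) <-> T f /\ T g).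

(** Of the ultrafilter only its formulas are kept; completeness and cofinality together already
    yield [T_tail]. *)
Definition type_at (x : cut) (T : form -> Prop) : Prop :=
  full_type T /\
  (forall m, x = principal m -> forall f, T f <-> sat M m f) /\
  ((forall m, x <> principal m) -> forall f, T f -> cofinal x (fun m => sat M m f)).

(** When a cofinal set is split by a formula, one part is cofinal. A decreasing sequence of cofinal
    sets deciding every formula thus generates a type. *)
Lemma type_at_exists (x : cut) : exists T, type_at x T.
Proof.
  destruct (classic (exists m, x = principal m)) as [[m ->]|G].
  - exists (sat M m). split; [|split].
    + unfold full_type. cbn. firstorder.
    + intros n E f. now apply principal_inj in E as ->.
    + intros N. now destruct (N m).
  - destruct (generic_sequence (M -> Prop) (fun S S' : M -> Prop => forall m, S m -> S' m) (cofinal x)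
        (fun f S => (forall m, S m -> sat M m f) \/ (forall m, S m -> ~ sat M m f))
        (fun _ => True)) as (s & _ & Hc & Hd & Hg).
    + auto.
    + auto.
    + intros f S C.
      destruct (classic (cofinal x (fun m => S m /\ sat M m f))) as [K|K].
      { exists (fun m => S m /\ sat M m f). firstorder. }
      exists (fun m => S m /\ ~ sat M m f). split; [|firstorder].
      apply not_all_ex_not in K as [k K]. apply imply_to_and in K as [Hk K].
      intros m Hm.
      (* [k'] is the larger of [m] and [k]; below the gap but beyond [k], no point of [S] satisfies
         [f]. *)
      assert (exists k', low x k' /\ ~ lt k' m /\ ~ lt k' k) as (k' & Hk' & L1 & L2).
      { destruct (classic (lt k m)); [exists m|exists k]; repeat split; auto.
        intros ?; now apply (lt_asym k m). }
      destruct (C k' Hk') as (n & Ln & Hn & Sn).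
      assert (forall l, ~ lt k' l -> lt l n) as U.
      { intros l Hl. destruct (tot k' l) as [|[<-|]]; [easy|easy|]. now apply (tr _ k'). }
      exists n. repeat split; auto. intros Sf. apply K. exists n. auto.
    + intros m Hm. destruct (low_open x m Hm) as (n & ? & ?). eauto.
    + assert (Con : forall n, exists m, s n m).
      { intros n. destruct (low_inhabited x) as [m Hm]. destruct (Hc n m Hm) as (k & _ & _ & ?). eauto. }
      assert (dir : forall n n', exists k, forall m, s k m -> s n m /\ s n' m).
      { intros n n'. exists (max n n'). intros m Hm. split; revert Hm; apply Hd; lia. }
      exists (fun f => exists n, forall m, s n m -> sat M m f). split; [|split].
      * split; [|split].
        -- exists 0. cbn. auto.
        -- intros f. split.
           ++ intros [n Hn] [n' Hn']. destruct (dir n n') as [k Hk]. destruct (Con k) as [m Hm].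
              apply Hk in Hm as [H1 H2]. now apply (Hn m H1), Hn'.
           ++ intros N. destruct (Hg f) as [n [H|H]]; [destruct N|]; exists n; auto.
        -- intros f g. split.
           ++ intros [n Hn]. split; exists n; intros m Hm; now apply Hn.
           ++ intros [[n Hn] [n' Hn']]. destruct (dir n n') as [k Hk]. exists k.
              intros m Hm. apply Hk in Hm as []. split; auto.
      * intros m ->. destruct G; eauto.
      * intros _ f [n Hn] m Hm. destruct (Hc n m Hm) as (k & ? & ? & ?). eauto.
Qed.

Section Type_assignment.
Context (T : cut -> form -> Prop).
Hypothesis T_type : forall x, type_at x (T x).

Lemma T_principal m f : T (principal m) f <-> sat M m f.
Proof. now apply T_type. Qed.

(** Otherwise [~~ f] would be in the type and hold cofinally. *)
Lemma T_tail (x : cut) a f :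
  (forall m, x <> principal m) -> low x a ->
  (forall m, low x m -> lt a m -> sat M m f) -> T x f.
Proof.
  intros G Ha H. destruct (T_type x) as ((_ & neg & _) & _ & cof).
  apply NNPP; intro N. apply neg in N. destruct (cof G _ N a Ha) as (n & L & Hn & K).
  now apply K, H.
Qed.

(** If [y] is a gap, [f] holds at old points below [y] but beyond the point [k] that separates [x]
    from [y]. *)
Lemma T_witness_above (x y : cut) f :
  cut_lt x y -> T y f -> exists m, ~ low x m /\ cut_lt x (principal m) /\ sat M m f.
Proof.
  intros L H. destruct (classic (exists m, y = principal m)) as [[m ->]|G].
  - exists m. rewrite <- T_principal. split; [now apply cut_lt_principal_r|]. auto.
  - destruct L as (k & Hk & Nk). destruct (T_type y) as (_ & _ & cof).
    destruct (cof (fun m e => G (ex_intro _ m e)) f H k Hk) as (m & Lm & _ & Sm).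
    exists m. split; [|split]; [|now exists k|easy].
    intros C. apply Nk. now apply (low_down x _ m).
Qed.

Lemma T_witness_below (x y : cut) f :
  cut_lt y x -> T y f -> exists m, low x m /\ sat M m f.
Proof.
  intros L H. destruct (classic (exists m, y = principal m)) as [[m ->]|G].
  - exists m. rewrite <- T_principal. split; [now apply cut_lt_principal_l|easy].
  - destruct L as (k & Hk & Nk). destruct (T_type y) as (_ & _ & cof).
    destruct (low_inhabited y) as [l Hl].
    destruct (cof (fun m e => G (ex_intro _ m e)) f H l Hl) as (m & _ & Hm & Sm).
    exists m. split; [|easy]. apply (low_down x _ k); [|easy]. now apply (low_above y).
Qed.

(** At a gap, all old points from [m] up to the gap lie between [m] and [n], so both diamonds hold
    on a whole tail. *)
Lemma T_Dia_intro (x : cut) f g m n :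
  low x m -> cut_lt x (principal n) -> sat M m f -> sat M n g ->
  T x (Dia f g) /\ T x (Dia g f).
Proof.
  intros Hm Hn Sf Sg.
  destruct (classic (exists k, x = principal k)) as [[k ->]|G].
  - rewrite !T_principal, !sat_Dia. rewrite cut_lt_principal in Hn. cbn in Hm.
    split; [exists m, n|exists n, m]; unfold order_betw; auto 8.
  - assert (forall k, low x k -> lt m k -> lt k n).
    { intros k Hk _. apply (low_above x); [easy|]. now apply cut_lt_principal_r. }
    assert (G' : forall k, x <> principal k) by (intros k E; apply G; now exists k).
    split; apply (T_tail x m); auto; intros k Hk L; apply sat_Dia.
    + exists m, n. unfold order_betw. auto 8.
    + exists n, m. unfold order_betw. auto 8.
Qed.

Lemma T_Dia_elim (x : cut) f g :
  T x (Dia f g) -> exists m n, low x m /\ cut_lt x (principal n) /\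
    (sat M m f /\ sat M n g \/ sat M m g /\ sat M n f).
Proof.
  intros H. destruct (classic (exists k, x = principal k)) as [[k ->]|G].
  - apply T_principal, sat_Dia in H as (m & n & Hm & Hn & [[L1 L2]|[L1 L2]]).
    + exists m, n. rewrite cut_lt_principal. auto.
    + exists n, m. rewrite cut_lt_principal. auto.
  - assert (G' : forall m, x <> principal m) by eauto.
    destruct (T_type x) as (_ & _ & cof). specialize (cof G' _ H). clear H.
    assert (up : exists n, ~ low x n /\ (sat M n f \/ sat M n g)).
    { apply NNPP; intro N.
      destruct (no_definable_gap x (f ||| g)) as (n & Hn & Sn); auto.
      (* One of the two witnesses at [n] lies beyond [n]; not being above the gap, it is a point of
         the lower half. *)
      - intros m Hm. destruct (cof m Hm) as (n & L & Hn & Sn).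
        assert (exists k, lt n k /\ (sat M k f \/ sat M k g)) as (k & Lk & Sk).
        { apply sat_Dia in Sn as (k & l & ? & ? & [[]|[]]); eauto. }
        exists k. split; [now apply (tr _ n)|]. split; [|now apply sat_Or].
        apply NNPP. eauto.
      - apply sat_Or in Sn. eauto. }
    destruct (low_inhabited x) as [a Ha]. destruct (cof a Ha) as (k & _ & Hk & Sk).

    apply sat_Dia in Sk as (m & n & Sm & Sn & B).
    assert (dec : forall l, low x l \/ cut_lt x (principal l)).
    { intros l. destruct (classic (low x l)); auto using gap_above. }
    destruct up as (u & Nu & Su). assert (Hu : cut_lt x (principal u)) by auto using gap_above.
    (* The witness before [k] is below the gap. If [u] satisfies the other formula, they form a
       pair; if not, the second witness pairs with [u] or with the first one, depending on its side
       of the gap. *)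
    destruct B as [[L1 L2]|[L2 L1]].
    + assert (low x m) by now apply (low_down x _ k).
      destruct Su as [Su|Su]; [|exists m, u; auto].
      destruct (dec n); [exists n, u|exists m, n]; auto.
    + assert (low x n) by now apply (low_down x _ k).
      destruct Su as [Su|Su]; [exists n, u; auto|].
      destruct (dec m); [exists m, u|exists n, m]; auto.
Qed.

Definition completion : model.
Proof.
  refine (Model (Frame cut (order_betw cut_lt)) (fun p x => T x (Var p))
            (fun i x => exists m, val_nom M i m /\ x = principal m) _).
  intros i. destruct (val_nom_singleton M i) as (m & Hm & U). exists (principal m). split; [eauto|].
  intros x (m' & Hm' & ->). now rewrite (U m' Hm').
Defined.

Lemma sat_completion f : forall x : cut, sat completion x f <-> T x f.
Proof.
  induction f as [|p|i|f IH|f IHf g IHg|f IHf g IHg|i f IH]; intros x;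
    destruct (T_type x) as ((top & neg & conj) & pr & cof).
  - cbn. tauto.
  - cbn. tauto.
  - destruct (val_nom_singleton M i) as (m & Hm & U).
    assert (E : sat completion x (Nom i) <-> x = principal m).
    { cbn. split.
      - intros H. symmetry. apply H. eauto.
      - intros -> v. split; [|intros ->; eauto]. intros (m' & Hm' & ->). now rewrite (U m' Hm'). }
    rewrite E. split.
    + intros ->. apply T_principal. now apply (sat_Nom i m).
    + intros H. apply NNPP; intro N. destruct (classic (exists k, x = principal k)) as [[k ->]|G].
      * apply T_principal, (sat_Nom i m) in H as ->; [now apply N|easy].
      (* A formula true at a single point is not cofinal, so no nominal is in the type of a gap. *)
      * specialize (cof (fun m e => G (ex_intro _ m e)) _ H).
        destruct (low_inhabited x) as [a Ha]. destruct (cof a Ha) as (n & _ & Hn & Sn).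
        destruct (cof n Hn) as (n' & L & _ & Sn').
        apply (sat_Nom i m) in Sn as ->; [|easy]. apply (sat_Nom i m) in Sn' as ->; [|easy].
        now apply irr in L.
  - rewrite neg, <- IH. reflexivity.
  - rewrite conj, <- IHf, <- IHg. reflexivity.
  - split.
    + intros (y & z & Hy & Hz & B). apply IHf in Hy. apply IHg in Hz. cbn in B.
      destruct B as [[L1 L2]|[L1 L2]].
      * destruct (T_witness_below x y f) as (m & ? & ?); auto.
        destruct (T_witness_above x z g) as (n & ? & ? & ?); auto.
        now apply (T_Dia_intro x f g m n).
      * destruct (T_witness_below x z g) as (m & ? & ?); auto.
        destruct (T_witness_above x y f) as (n & ? & ? & ?); auto.
        now apply (T_Dia_intro x g f m n).
    + intros H. apply T_Dia_elim in H as (m & n & Hm & Hn & S).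
      apply cut_lt_principal_l in Hm.
      destruct S as [[S1 S2]|[S1 S2]]; apply T_principal in S1, S2;
        [exists (principal m), (principal n)|exists (principal n), (principal m)]; cbn;
        rewrite IHf, IHg; unfold order_betw; auto 8.
  - destruct (val_nom_singleton M i) as (m & Hm & U).
    assert (E : sat completion x (At i f) <-> sat M m f).
    { rewrite <- T_principal, <- IH. cbn. split.
      - intros (v & (m' & Hm' & ->) & H). now rewrite (U m' Hm').
      - intros H. eauto. }
    (* The truth of [At i f] does not depend on the point: it holds cofinally iff it holds
       everywhere. *)
    assert (E' : forall n, sat M n (At i f) <-> sat M m f).
    { intros n. cbn. split; [|eauto]. intros (m' & Hm' & H). now rewrite (U m' Hm'). }
    rewrite E. destruct (classic (exists k, x = principal k)) as [[k ->]|G].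
    + rewrite T_principal. now rewrite E'.
    + destruct (low_inhabited x) as [a Ha]. split.
      * intros H. apply (T_tail x a); [intros m' Em; apply G; now exists m'|easy|].
        intros n _ _. now apply E'.
      * intros H. destruct (cof (fun m e => G (ex_intro _ m e)) _ H a Ha) as (n & _ & _ & Sn).
        now apply E' in Sn.
Qed.
End Type_assignment.

Lemma completion_exists :
  exists (M' : model) (e : M -> M'),
    CDLBWE M' /\ forall w f, sat M' (e w) f <-> sat M w f.
Proof.
  destruct (functional_choice _ type_at_exists) as [T HT].
  exists (completion T), principal. split.
  - split.
    + exact (order_betw_DLBWE _ _ cut_order).
    + exact (order_betw_B9 _ _ cut_order cut_sup).
  - intros w f. rewrite sat_completion; auto. now apply T_principal.
Qed.

End Completion.

(** * Derived theorems *)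

Notation "|- f" := (Bh_plus_provable f) (at level 70).

Ltac taut :=
  let a := fresh in
  intro a; unfold Ef, Af, Cf, Box, Iff, Imp, Or, conj_list; cbn;
  repeat match goal with
  | |- context [bool_eval a ?f] => destruct (bool_eval a f)
  | |- context [a ?f] => destruct (a f)
  end; reflexivity.

Lemma pr_taut f : tautology f -> |- f.
Proof. intros H. apply pr_axiom. left. now apply ax_taut. Qed.

Lemma from1 f g : |- f -> tautology (f --> g) -> |- g.
Proof. intros F H. exact (pr_mp _ _ _ (pr_taut _ H) F). Qed.

Lemma from2 f g h : |- f -> |- g -> tautology (f --> g --> h) -> |- h.
Proof. intros F G H. exact (pr_mp _ _ _ (from1 _ _ F H) G). Qed.

Lemma from3 f g h k : |- f -> |- g -> |- h -> tautology (f --> g --> h --> k) -> |- k.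
Proof. intros F G K H. exact (pr_mp _ _ _ (from2 _ _ _ F G H) K). Qed.

(** Nominals need no such assignment, as the axioms range over all of them. *)
Definition vars3 (f g h : form) (p : pvar) : form :=
  match p with 0 => f | 1 => g | _ => h end.

Lemma pr_instance a f g h : Bh_axiom a -> |- subst (vars3 f g h) (fun i => i) a.
Proof. intros H. apply pr_subst, pr_axiom. now left. Qed.

(** [Box] being an abbreviation, this inserts or removes double negations inside [Dia], where
    tautologies do not reach. *)
Lemma pr_dual f g : |- ~~ Dia f g <--> Box (~~ f) (~~ g).
Proof. exact (pr_instance _ f g Top (ax_dual 0 1)). Qed.

Lemma Dia_mono_l f f' g : |- f --> f' -> |- Dia f g --> Dia f' g.
Proof.
  intros H. assert (H' : |- ~~ f' --> ~~ f) by (apply (from1 _ _ H); taut).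
  apply (pr_nec_left _ _ (~~ g)) in H'.
  pose proof (pr_mp _ _ _ (pr_instance _ (~~ f') (~~ f) (~~ g) (ax_K_left 0 1 2)) H') as K.
  apply (from3 _ _ _ _ K (pr_dual f g) (pr_dual f' g)). taut.
Qed.

Lemma Dia_mono_r f g g' : |- g --> g' -> |- Dia f g --> Dia f g'.
Proof.
  intros H. assert (H' : |- ~~ g' --> ~~ g) by (apply (from1 _ _ H); taut).
  apply (pr_nec_right _ _ (~~ f)) in H'.
  pose proof (pr_mp _ _ _ (pr_instance _ (~~ g') (~~ g) (~~ f) (ax_K_right 0 1 2)) H') as K.
  apply (from3 _ _ _ _ K (pr_dual f g) (pr_dual f g')). taut.
Qed.

(** This is axiom K contraposed, with the double negations cleared. *)
Lemma Dia_split_l f f' g : |- Dia f g --> Dia f' g ||| Dia (f &&& ~~ f') g.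
Proof.
  pose proof (pr_instance _ (~~ f') (~~ f) (~~ g) (ax_K_left 0 1 2)) as K.
  assert (H1 : |- ~~ (~~ f' --> ~~ f) --> f &&& ~~ f') by (apply pr_taut; taut).
  assert (H2 : |- ~~ ~~ g --> g) by (apply pr_taut; taut).
  assert (K' : |- Dia (~~ (~~ f' --> ~~ f)) (~~ ~~ g) --> Dia (f &&& ~~ f') g).
  { apply (from2 _ _ _ (Dia_mono_l _ _ (~~ ~~ g) H1) (Dia_mono_r (f &&& ~~ f') _ _ H2)). taut. }
  assert (K2 : |- Box (~~ f') (~~ g) --> Box (~~ f) (~~ g) ||| Dia (f &&& ~~ f') g).
  { apply (from2 _ _ _ K' K). taut. }
  apply (from3 _ _ _ _ K2 (pr_dual f g) (pr_dual f' g)). taut.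
Qed.

Lemma Dia_split_r f g g' : |- Dia f g --> Dia f g' ||| Dia f (g &&& ~~ g').
Proof.
  pose proof (pr_instance _ (~~ g') (~~ g) (~~ f) (ax_K_right 0 1 2)) as K.
  assert (H1 : |- ~~ (~~ g' --> ~~ g) --> g &&& ~~ g') by (apply pr_taut; taut).
  assert (H2 : |- ~~ ~~ f --> f) by (apply pr_taut; taut).
  assert (K' : |- Dia (~~ ~~ f) (~~ (~~ g' --> ~~ g)) --> Dia f (g &&& ~~ g')).
  { apply (from2 _ _ _ (Dia_mono_r (~~ ~~ f) _ _ H1) (Dia_mono_l _ _ (g &&& ~~ g') H2)). taut. }
  assert (K2 : |- Box (~~ f) (~~ g') --> Box (~~ f) (~~ g) ||| Dia f (g &&& ~~ g')).
  { apply (from2 _ _ _ K' K). taut. }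
  apply (from3 _ _ _ _ K2 (pr_dual f g) (pr_dual f g')). taut.
Qed.

(* The points of the first argument other than those satisfying [f] would satisfy [At j (~~ f)]. *)
Lemma Dia_bridge_l j f g : |- Dia (Nom j) g &&& At j f --> Dia f g.
Proof.
  pose proof (Dia_split_l (Nom j) f g) as S.
  pose proof (pr_instance _ (~~ f) Top Top (ax_intro j 0)) as I.
  pose proof (pr_instance _ (~~ f) g Top (ax_back_left j 0 1)) as K.
  pose proof (pr_instance _ f Top Top (ax_selfdual j 0)) as N.
  pose proof (Dia_mono_l _ _ g I) as I'.
  apply (from3 _ _ _ _ S N (from2 _ _ (Dia (Nom j &&& ~~ f) g --> At j (~~ f)) I' K ltac:(taut))). taut.
Qed.

Lemma Dia_bridge_r j f g : |- Dia f (Nom j) &&& At j g --> Dia f g.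
Proof.
  pose proof (Dia_split_r f (Nom j) g) as S.
  pose proof (pr_instance _ (~~ g) Top Top (ax_intro j 0)) as I.
  pose proof (pr_instance _ (~~ g) f Top (ax_back_right j 0 1)) as K.
  pose proof (pr_instance _ g Top Top (ax_selfdual j 0)) as N.
  pose proof (Dia_mono_r f _ _ I) as I'.
  apply (from3 _ _ _ _ S N (from2 _ _ (Dia f (Nom j &&& ~~ g) --> At j (~~ g)) I' K ltac:(taut))). taut.
Qed.

Lemma pr_D f g : |- D_instance f g.
Proof.
  change (|- subst (vars3 f g Top) (fun i => i) (D_instance (Var 0) (Var 1))).
  apply pr_subst, pr_axiom. right. apply ax_D.
Qed.

(** * Named maximal consistent sets *)

Lemma nom_occurs_bound f : exists N, forall i, nom_occurs i f -> i < N.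
Proof.
  induction f as [|p|i|f [N H]|f [N H] g [N' H']|f [N H] g [N' H']|i f [N H]].
  - now exists 0.
  - now exists 0.
  - exists (S i). cbn. lia.
  - now exists N.
  - exists (N + N'). cbn. intros i [K|K]; [apply H in K|apply H' in K]; lia.
  - exists (N + N'). cbn. intros i [K|K]; [apply H in K|apply H' in K]; lia.
  - exists (S i + N). cbn. intros j [K|K]; [|apply H in K]; lia.
Qed.

Record maximal (D : form -> Prop) : Prop := {
  max_theorem : forall f, |- f -> D f;
  max_mp : forall f g, D (f --> g) -> D f -> D g;
  max_neg : forall f, D (~~ f) <-> ~ D f
}.

Lemma maximal_full D : maximal D -> full_type D.
Proof.
  intros [th mp neg].
  assert (cut1 : forall f g, tautology (f --> g) -> D f -> D g)
    by (intros f g H; apply mp, th, pr_taut, H).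
  split; [|split]; [|easy|].
  - apply th, pr_taut. taut.
  - intros f g. split.
    + intros H. split; revert H; apply cut1; taut.
    + intros [F G]. apply (mp g); [|easy]. revert F. apply cut1. taut.
Qed.

Definition pasted (D : form -> Prop) : Prop :=
  forall i f g, D (At i (Dia f g)) ->
    exists j k, D (At i (Dia (Nom j) (Nom k))) /\ D (At j f) /\ D (At k g).

(** [G] may mention every nominal; after doubling, the odd ones are fresh. *)
Definition even_nominals (f : form) : Prop := forall i, nom_occurs i f -> Nat.even i = true.

Lemma even_conj l : (forall f, In f l -> even_nominals f) -> even_nominals (conj_list l).
Proof.
  induction l as [|f l IH]; cbn; [easy|]. intros H i [K|K].
  - now apply (H f (or_introl eq_refl)).
  - apply IH; auto.
Qed.

Lemma pr_conj_app l l' : |- conj_list (l ++ l') --> conj_list l &&& conj_list l'.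
Proof.
  induction l as [|f l IH]; cbn.
  - apply pr_taut. taut.
  - apply (from1 _ _ IH). taut.
Qed.

(** A condition is a single formula, the conjunction of what has been added to [G]; it mentions
    finitely many nominals, so fresh odd ones always remain. *)
Lemma henkin (G : form -> Prop) :
  (forall f, G f -> even_nominals f) -> Bh_plus_consistent G ->
  exists D, maximal D /\ pasted D /\ (forall f, G f -> D f) /\ exists i, D (Nom i).
Proof.
  intros even con.
  set (Con := fun c => forall l, (forall f, In f l -> G f) -> ~ |- conj_list l --> ~~ c).
  destruct (generic_sequence form (fun c d => |- c --> d) Con
    (fun f c => |- c --> ~~ f \/ |- c --> f /\
       forall i g h, f = At i (Dia g h) ->
         exists j k, |- c --> At i (Dia (Nom j) (Nom k)) &&& At j g &&& At k h) (Nom 1))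
    as (s & s0 & Hc & Hd & Hg).
  - intros f. apply pr_taut. taut.
  - intros f g h H K. apply (from2 _ _ _ H K). taut.
  - intros f c Cc.
    destruct (classic (Con (c &&& f))) as [C|C].
    + destruct (classic (exists i g h, f = At i (Dia g h))) as [(i & g & h & ->)|N].
      * destruct (nom_occurs_bound (c &&& At i (Dia g h))) as [N HN].
        (* Odd, hence absent from [G]; not below [N], hence absent from [c] and [At i (Dia g h)]. *)
        set (j := 2 * N + 1). set (k := 2 * N + 3).
        assert (Hj : Nat.even j = false) by (unfold j; now rewrite Nat.even_add, Nat.even_mul).
        assert (Hk : Nat.even k = false) by (unfold k; now rewrite Nat.even_add, Nat.even_mul).
        exists (c &&& At i (Dia g h) &&& (At i (Dia (Nom j) (Nom k)) &&& At j g &&& At k h)).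
        split; [|split].
        -- intros l Hl P. apply (C l Hl).
           assert (fresh : forall m, N <= m -> Nat.even m = false ->
              ~ nom_occurs m c /\ i <> m /\ ~ nom_occurs m g /\ ~ nom_occurs m h /\
              ~ nom_occurs m (conj_list l)).
           { intros m L E. cbn in HN.
             repeat split; try (intros K; assert (m < N) by (apply HN; auto); lia).
             intros K. apply even_conj in K; [congruence|auto]. }
           destruct (fresh j) as (?&?&?&?&?); [lia|easy|].
           destruct (fresh k) as (?&?&?&?&?); [lia|easy|].
           (* Paste needs a conclusion free of [j] and [k]; it repeats [At i (Dia g h)], which [P]
              also refers to. *)
           assert (|- At i (Dia g h) --> ~~ (conj_list l &&& c &&& At i (Dia g h))) as Q.
           { apply (pr_paste _ i j k); auto; try lia.
             1,2: cbn; intuition lia.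
             apply (from1 _ _ P). taut. }
           apply (from1 _ _ Q). taut.
        -- apply pr_taut. taut.
        -- right. split; [apply pr_taut; taut|].
           intros i' g' h' [= <- <- <-]. exists j, k. apply pr_taut. taut.
      * exists (c &&& f). split; [easy|]. split; [apply pr_taut; taut|].
        right. split; [apply pr_taut; taut|]. intros i g h E. destruct N. now exists i, g, h.
    + exists (c &&& ~~ f). split; [|split; [|left]]; [|apply pr_taut; taut..].
      (* Refutations of [c &&& f] from [l'] and of [c &&& ~~ f] from [l] combine to one of [c] from
         [l ++ l']. *)
      intros l Hl P. apply not_all_ex_not in C as [l' C]. apply imply_to_and in C as [Hl' C].
      apply NNPP in C. apply (Cc (l ++ l')).
      { intros h K. apply in_app_or in K as []; auto. }
      apply (from3 _ _ _ _ P C (pr_conj_app l l')). taut.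
  (* The starting condition [Nom 1] is consistent by the rule Name, as 1 is odd and so does not
     occur in [l]. *)
  - intros l Hl P. apply (con l Hl). apply (pr_name _ 1).
    + cbn. intros K. apply even_conj in K; [easy|auto].
    + apply (from1 _ _ P). taut.
  - assert (cons : forall n, ~ |- ~~ s n).
    { intros n P. apply (Hc n []); [easy|]. cbn. apply (from1 _ _ P). taut. }
    assert (dir : forall m n f g, |- s m --> f -> |- s n --> g ->
        |- s (max m n) --> f &&& g).
    { intros m n f g F K.
      pose proof (Hd m (max m n) ltac:(lia)) as F'. pose proof (Hd n (max m n) ltac:(lia)) as K'.
      apply (from3 _ _ _ _ F F' (from2 _ _ (s (max m n) --> g) K K' ltac:(taut))). taut. }
    exists (fun f => exists n, |- s n --> f). split; [split|split; [|split]].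
    + intros f F. exists 0. apply (from1 _ _ F). taut.
    + intros f g [m F] [n K]. exists (max m n). apply (from1 _ _ (dir _ _ _ _ F K)). taut.
    + intros f. split.
      * intros [m F] [n K]. apply (cons (max m n)). apply (from1 _ _ (dir _ _ _ _ F K)). taut.
      * intros N. destruct (Hg f) as [n [H|[H _]]]; [now exists n|]. destruct N. now exists n.
    + intros i f g [n F]. destruct (Hg (At i (Dia f g))) as [m [K|[_ K]]].
      * destruct (cons (max m n)). apply (from1 _ _ (dir _ _ _ _ K F)). taut.
      * destruct (K _ _ _ eq_refl) as (j & k & H). exists j, k.
        repeat split; exists m; apply (from1 _ _ H); taut.
    + intros f Gf. destruct (Hg f) as [n [H|[H _]]]; [|now exists n].
      destruct (Hc n [f]); [now intros h [<-|[]]|]. cbn. apply (from1 _ _ H). taut.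
    + exists 1, 0. rewrite s0. apply pr_taut. taut.
Qed.

(** * The named model *)

Section Named_model.
Context (D : form -> Prop) (HD : maximal D) (HP : pasted D).

Definition theory (i : nominal) (f : form) : Prop := D (At i f).

Lemma D_mono f g : |- f --> g -> D f -> D g.
Proof. intros H. apply (max_mp D HD). now apply (max_theorem D HD). Qed.

Lemma D_and f g : D f -> D g -> D (f &&& g).
Proof. intros F G. apply (maximal_full D HD). auto. Qed.

Lemma theory_maximal i : maximal (theory i).
Proof.
  split; unfold theory.
  - intros f F. apply (max_theorem D HD). now apply pr_nec_at.
  - intros f g. intros H. apply (max_mp D HD). revert H. apply D_mono.
    exact (pr_instance _ f g Top (ax_K_at i 0 1)).
  - intros f. rewrite <- (max_neg D HD). pose proof (pr_instance _ f Top Top (ax_selfdual i 0)) as K.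
    split; apply D_mono; apply (from1 _ _ K); taut.
Qed.

Lemma theory_refl i : theory i (Nom i).
Proof. apply (max_theorem D HD), (pr_instance _ Top Top Top (ax_ref i)). Qed.

Lemma theory_sym i j : theory i (Nom j) -> theory j (Nom i).
Proof. apply D_mono, (pr_instance _ Top Top Top (ax_sym j i)). Qed.

Lemma theory_eq i j : theory i = theory j <-> theory i (Nom j).
Proof.
  split; [intros ->; apply theory_refl|].
  assert (H : forall i j f, theory i (Nom j) -> theory j f -> theory i f).
  { intros i' j' f K L. apply (D_mono (At i' (Nom j') &&& At j' f)); [|now apply D_and].
    exact (pr_instance _ f Top Top (ax_nom i' j' 0)). }
  intros K. extensionality f. apply propositional_extensionality. split; eauto using theory_sym.
Qed.

(** [ax_agree] gives one direction; applied to [~~ f], it gives the other by self-duality. *)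
Lemma theory_At i j f : theory i (At j f) <-> theory j f.
Proof.
  assert (H : forall g, theory i (At j g) -> theory j g)
    by (intros g; exact (D_mono _ _ (pr_instance _ g Top Top (ax_agree i j 0)))).
  split; [apply H|]. intros F. apply NNPP; intro N.
  apply (max_neg _ (theory_maximal i)) in N.
  apply (max_neg _ (theory_maximal j) f); [|easy]. apply H. revert N.
  apply (max_mp _ (theory_maximal i)), (max_theorem _ (theory_maximal i)).
  pose proof (pr_instance _ f Top Top (ax_selfdual j 0)) as K. apply (from1 _ _ K). taut.
Qed.

Lemma theory_Dia i f g :
  theory i (Dia f g) <-> exists j k, theory i (Dia (Nom j) (Nom k)) /\ theory j f /\ theory k g.
Proof.
  split; [apply HP|]. intros (j & k & H & F & G).
  apply (theory_At i) in F, G.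
  pose proof (theory_maximal i) as Mi. pose proof (maximal_full _ Mi) as (_ & _ & conj).
  apply (max_mp _ Mi (Dia f (Nom k) &&& At k g)).
  { apply (max_theorem _ Mi), Dia_bridge_r. }
  apply conj. split; [|easy].
  apply (max_mp _ Mi (Dia (Nom j) (Nom k) &&& At j f)).
  { apply (max_theorem _ Mi), Dia_bridge_l. }
  now apply conj.
Qed.

(** Equality of theories replaces a quotient of the nominals by [theory i (Nom j)]. *)
Definition point : Type := {S : form -> Prop | exists i, S = theory i}.

Definition point_of (i : nominal) : point := exist _ (theory i) (ex_intro _ i eq_refl).

Lemma point_of_eq i j : point_of i = point_of j <-> theory i (Nom j).
Proof.
  rewrite <- theory_eq. split; [intros H; injection H; auto|].
  intros E. now apply subset_eq_compat.
Qed.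

Lemma point_named (x : point) : exists i, x = point_of i.
Proof. destruct x as [S [i ->]]. now exists i. Qed.

Definition named_model : model.
Proof.
  (* Betweenness asks for some names of the end points, so no independence of representatives has to
     be shown. *)
  refine (Model
    (Frame point (fun x y z => exists i k,
       x = point_of i /\ z = point_of k /\ proj1_sig y (Dia (Nom i) (Nom k))))
    (fun p x => proj1_sig x (Var p)) (fun i x => x = point_of i) _).
  intros i. exists (point_of i). split; [easy|]. now intros x ->.
Defined.

Lemma sat_named_model f : forall x : named_model, sat named_model x f <-> proj1_sig x f.
Proof.
  induction f as [|p|i|f IH|f IHf g IHg|f IHf g IHg|i f IH]; intros x;
    destruct (point_named x) as [n ->];
    pose proof (maximal_full _ (theory_maximal n)) as (top & neg & conj).
  - cbn. tauto.
  - cbn. tauto.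
  - cbn. rewrite <- point_of_eq. split.
    + intros H. symmetry. now apply H.
    + intros ->. easy.
  - cbn. now rewrite neg, IH.
  - cbn. now rewrite conj, IHf, IHg.
  - cbn [proj1_sig point_of]. rewrite theory_Dia. cbn [sat]. split.
    + intros (x & y & Hx & Hy & j & k & -> & -> & B). exists j, k.
      apply IHf in Hx. apply IHg in Hy. auto.
    + intros (j & k & B & F & G). exists (point_of j), (point_of k).
      rewrite IHf, IHg. repeat split; auto. now exists j, k.
  - cbn [proj1_sig point_of]. rewrite theory_At. cbn [sat]. split.
    + intros (v & -> & H). now apply IH in H.
    + intros H. exists (point_of i). split; [easy|]. now apply IH.
Qed.

Lemma named_model_sound f (x : named_model) : |- f -> sat named_model x f.
Proof.
  intros F. apply sat_named_model. destruct (point_named x) as [i ->].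
  now apply (max_theorem _ (theory_maximal i)).
Qed.

End Named_model.

(** * Frame conditions from the axioms about nominals *)

Section Named_frame.
Context (M : model).
Hypothesis named : forall w : M, exists i, val_nom M i w.
Hypothesis sound : forall f w, |- f -> sat M w f.

Let nom i (w v : M) (H : val_nom M i w) : sat M v (Nom i) <-> v = w := sat_Nom M i w v H.

Lemma sat_At i (v w : M) f : val_nom M i v -> (sat M w (At i f) <-> sat M v f).
Proof.
  intros H. destruct (val_nom_singleton M i) as (m & Hm & U). cbn. split; [|eauto].
  intros (v' & K & F). now rewrite <- (U v H), (U v' K).
Qed.

Lemma sat_Dia_Nom i k (x y z : M) :
  val_nom M i x -> val_nom M k z -> (sat M y (Dia (Nom i) (Nom k)) <-> betw x y z).
Proof.
  intros Hx Hz. cbn [sat]. split.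
  - intros (x' & z' & Kx & Kz & B).
    apply (nom i x) in Kx as ->; [|easy]. now apply (nom k z) in Kz as ->.
  - intros B. exists x, z. split; [now apply (nom i x)|]. split; [now apply (nom k z)|easy].
Qed.

Lemma ax_sound f w : Bh_axiom f -> sat M w f.
Proof. intros H. apply sound, pr_axiom. now left. Qed.

Ltac name x i Hi := destruct (named x) as [i Hi].

Lemma named_B1 (x y z : M) : betw x y z -> distinct3 x y z.
Proof.
  name x i Hi. name y j Hj. name z k Hk. intros B.
  apply (sat_Dia_Nom i k) in B; auto. pose proof (ax_sound _ x (ax_B1 j i k)) as A.
  rewrite sat_Imp, !sat_And, !sat_Neg, !(sat_At _ _ _ _ Hj), !(sat_At _ _ _ _ Hk),
    !(nom _ _ _ Hi), (nom _ _ _ Hk) in A.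
  destruct (A B) as [[N1 N2] N3]. repeat split; congruence.
Qed.

Lemma named_B2 (x y z : M) : betw x y z -> betw z y x.
Proof.
  name x i Hi. name z k Hk. pose proof (ax_sound _ y (ax_B2 i k)) as A.
  rewrite sat_Imp, (sat_Dia_Nom _ _ _ _ _ Hi Hk), (sat_Dia_Nom _ _ _ _ _ Hk Hi) in A. exact A.
Qed.

Lemma named_B3 (x y z : M) : betw x y z -> ~ betw x z y.
Proof.
  name x i Hi. name y j Hj. name z k Hk. pose proof (ax_sound _ y (ax_B3 i j k)) as A.
  now rewrite sat_Imp, sat_Neg, (sat_At _ _ _ _ Hj), (sat_At _ _ _ _ Hk),
    (sat_Dia_Nom _ _ _ _ _ Hi Hk), (sat_Dia_Nom _ _ _ _ _ Hi Hj) in A.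
Qed.

Lemma named_B4 (x y z u : M) : betw x y z -> betw y z u -> betw x y u.
Proof.
  name x i Hi. name y j Hj. name z k Hk. name u l Hl. pose proof (ax_sound _ y (ax_B4 i j k l)) as A.
  rewrite sat_Imp, !sat_And, !(sat_At _ _ _ _ Hj), !(sat_At _ _ _ _ Hk),
    (sat_Dia_Nom _ _ _ _ _ Hi Hk), (sat_Dia_Nom _ _ _ _ _ Hj Hl), !(sat_Dia_Nom _ _ _ _ _ Hi Hl) in A.
  tauto.
Qed.

Lemma named_B5 (x y z u : M) : betw x y z -> betw y u z -> betw x y u.
Proof.
  (* The axiom subdivides the segment next to its first end, so the names of [x] and [z] are
     exchanged and the result is reflected by [named_B2]. *)
  name x k Hk. name y j Hj. name z i Hi. name u l Hl. pose proof (ax_sound _ y (ax_B5 i j k l)) as A.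
  rewrite sat_Imp, !sat_And, !(sat_At _ _ _ _ Hj), !(sat_At _ _ _ _ Hl),
    !(sat_Dia_Nom _ _ _ _ _ Hi Hk), (sat_Dia_Nom _ _ _ _ _ Hi Hj), !(sat_Dia_Nom _ _ _ _ _ Hl Hk) in A.
  intros B B'. apply named_B2, A. split; now apply named_B2.
Qed.

Lemma named_B6 (x y z : M) : distinct3 x y z -> betw x y z \/ betw x z y \/ betw y x z.
Proof.
  name x i Hi. name y j Hj. name z k Hk. intros (n1 & n2 & n3). pose proof (ax_sound _ y (ax_B6 i j k)) as A.
  rewrite sat_Imp, !sat_Or, !sat_And, !sat_Neg in A.
  rewrite !(sat_At _ _ _ _ Hi), !(sat_At _ _ _ _ Hj), !(sat_At _ _ _ _ Hk),
    (sat_Dia_Nom _ _ _ _ _ Hi Hk), (sat_Dia_Nom _ _ _ _ _ Hi Hj), (sat_Dia_Nom _ _ _ _ _ Hj Hk) in A.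
  rewrite !(nom _ _ _ Hj), !(nom _ _ _ Hk) in A. intuition auto.
Qed.

Lemma named_B7 (y : M) : exists x z : M, betw x y z.
Proof. destruct (ax_sound _ y ax_B7) as (x & z & _ & _ & B). now exists x, z. Qed.

Lemma named_B8 (x y z : M) : betw x y z -> exists u v : M, betw x u z /\ betw x v z /\ betw u y v.
Proof.
  name x i Hi. name z k Hk. intros B. pose proof (ax_sound _ y (ax_B8 i k)) as A.
  rewrite sat_Imp, (sat_Dia_Nom _ _ _ _ _ Hi Hk) in A. destruct (A B) as (u & v & Hu & Hv & B').
  (* The ends of a betweenness are distinct, so one of them is [x] and the other [z]. *)
  assert (K : forall w, sat M w (Cf (Nom i ||| Nom k)) -> betw x w z).
  { intros w (a & b & Ha & Hb & L). rewrite sat_Or, (nom _ _ _ Hi), (nom _ _ _ Hk) in Ha.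
    rewrite sat_Or, (nom _ _ _ Hi), (nom _ _ _ Hk) in Hb.
    destruct (named_B1 _ _ _ L) as (_ & n & _).
    destruct Ha as [-> | ->], Hb as [-> | ->]; try easy. now apply named_B2. }
  exists u, v. auto.
Qed.
End Named_frame.

(** * Freeing nominals and conclusion *)

Lemma subst_cancel (t t' : nominal -> nominal) f :
  (forall i, t' (t i) = i) -> subst Var t' (subst Var t f) = f.
Proof. intros H. induction f; cbn; rewrite ?H; congruence. Qed.

Lemma subst_conj_list s t l : subst s t (conj_list l) = conj_list (map (subst s t) l).
Proof. induction l as [|f l IH]; [easy|]. cbn. f_equal. exact IH. Qed.

Lemma even_subst_double f : even_nominals (subst Var Nat.double f).
Proof.
  intros i. induction f; cbn; try easy; try tauto.
  - intros ->. now rewrite Nat.double_twice, Nat.even_mul.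
  - intros [->|]; [now rewrite Nat.double_twice, Nat.even_mul|auto].
Qed.

(** Halving the nominals is a uniform substitution, so it turns a refutation of the doubled set into
    one of [G]. *)
Lemma consistent_double (G : form -> Prop) :
  Bh_plus_consistent G ->
  Bh_plus_consistent (fun f => exists g, G g /\ f = subst Var Nat.double g).
Proof.
  intros con l Hl P. apply (con (map (subst Var Nat.div2) l)).
  - intros f K. apply in_map_iff in K as (f' & <- & K). apply Hl in K as (g & Gg & ->).
    rewrite subst_cancel; [easy|]. intros i. rewrite Nat.double_twice. apply Nat.div2_double.
  - rewrite <- subst_conj_list. exact (pr_subst _ Var Nat.div2 _ P).
Qed.

Definition rename_nominals (t : nominal -> nominal) (M : model) : model :=
  Model (mframe M) (val_var M) (fun i => val_nom M (t i)) (fun i => val_nom_singleton M (t i)).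

Lemma sat_rename t (M : model) f : forall w : M,
  sat (rename_nominals t M) w f <-> sat M w (subst Var t f).
Proof.
  induction f as [|p|i|f IH|f IHf g IHg|f IHf g IHg|i f IH]; intros w; cbn; try tauto.
  - now rewrite IH.
  - now rewrite IHf, IHg.
  - split; intros (x & y & F & G & B); exists x, y; apply IHf in F; apply IHg in G; auto.
  - split; intros (v & Hv & F); exists v; apply IH in F; auto.
Qed.

Theorem theorem7p22 :
  forall G : form -> Prop,
    Bh_plus_consistent G ->
    exists (M : model) (w : M),
      CDLBWE (mframe M) /\ forall f : form, G f -> sat M w f.
Proof.
  intros G con. apply consistent_double in con.
  destruct (henkin _ (fun f H => match H with ex_intro _ g (conj _ e) =>
    eq_ind_r even_nominals (even_subst_double g) e end) con) as (D & HD & HP & HG & i & Hi).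
  set (M := named_model D).
  assert (named : forall w : M, exists j, val_nom M j w) by (intros w; exact (point_named D w)).
  pose proof (fun f w => named_model_sound D HD HP f w) as sound. fold M in sound.
  assert (exists lt, dense_order lt /\ forall x y z : M, betw x y z <-> order_betw lt x y z)
    as (lt & O & E).
  { apply betw_order; [eauto using named_B1, named_B2, named_B3, named_B4,
      named_B5, named_B6, named_B7, named_B8 ..|exact (point_of D i)]. }
  destruct (completion_exists M lt O E named) as (M' & e & C & S).
  { intros f g w. apply sound, pr_D. }
  (* Letting [i] denote what [Nat.double i] denoted in [M'] undoes the doubling. *)
  exists (rename_nominals Nat.double M'), (e (point_of D i)). split; [exact C|].
  intros f Gf. apply sat_rename, S, (sat_named_model D HD HP).
  (* Since [Nom i] is in [D], [ax_intro] carries every member of [D] into the theory of [i]. *)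
  apply (D_mono D HD (Nom i &&& subst Var Nat.double f)).
  - exact (pr_instance _ (subst Var Nat.double f) Top Top (ax_intro i 0)).
  - apply (D_and D HD); [easy|]. apply HG. now exists f.
Qed.
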